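(* For every $n\geq 1$, the triangular snake graph $TS_n$ satisfies $F_d(TS_n)=Z(TS_n)=n+1$.
   Context: The triangular snake graph $TS_n$ is obtained from a path $P_{n+1}$ on $n+1$ vertices by replacing each edge of the path by a triangle $C_3$. Explicitly, it has vertices $v_1,\dots,v_{n+1},u_1,\dots,u_n$, and edges $v_iv_{i+1}$, $u_iv_i$, $u_iv_{i+1}$ for $1\le i\le n$. Zero forcing: given a set $B\subseteq V(G)$ of initially black vertices (all others white) of a finite simple graph $G$, at each step a black vertex having exactly one white neighbor forces that neighbor to become black; $B$ is a zero forcing set of $G$ if repeated application of this rule turns all vertices black. $Z(G)$ is the minimum cardinality of a zero forcing set. A set $D\subseteq V(G)$ is dominating if every vertex of $G$ is in $D$ or adjacent to a vertex of $D$. A dom-forcing set of $G$ is a set $D_f\subseteq V(G)$ that is both a dominating set of $G$ and a zero forcing set of $G$; the dom-forcing number $F_d(G)$ is the minimum cardinality of a dom-forcing set. *)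

(* Defs.v *)
From mathcomp Require Import all_boot.

Set Implicit Arguments.
Unset Strict Implicit.
Unset Printing Implicit Defensive.

Record sgraph := SGraph {
  vertex :> finType;
  adj : rel vertex;
  adj_sym : symmetric adj;
  adj_irrefl : irreflexive adj
}.

Section ZeroForcing.
Variable G : sgraph.
Implicit Types (B D : {set G}) (v w : G).

Definition neigh v : {set G} := [set w | adj v w].

Definition white_neigh B v : {set G} := neigh v :\: B.

(* One application of the colour-change rule to the set B of black vertices:
   some black v has w as its unique white neighbour, and w becomes black. *)
Definition force_step : rel {set G} := fun B B' =>
  [exists v in B, [exists w, (white_neigh B v == [set w]) && (B' == w |: B)]].

(* connect is the reflexive-transitive closure. *)
Definition zero_forcing : pred {set G} := fun B =>
  connect force_step B [set: G].

Definition dominating : pred {set G} := fun D =>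
  [forall v, (v \in D) || [exists w in D, adj v w]].

Definition dom_forcing : pred {set G} := fun D =>
  dominating D && zero_forcing D.

Lemma zero_forcingT : zero_forcing [set: G].
Proof. exact: connect0. Qed.

Lemma dom_forcingT : dom_forcing [set: G].
Proof.
by rewrite /dom_forcing zero_forcingT andbT; apply/forallP=> v; rewrite inE.
Qed.

(* The default [set: G] satisfies the predicates by zero_forcingT and
   dom_forcingT, so arg min returns a genuine minimizer. *)
Definition zero_forcing_number : nat :=
  #|[arg min_(B < [set: G] | zero_forcing B) #|B|]|.

Definition dom_forcing_number : nat :=
  #|[arg min_(D < [set: G] | dom_forcing D) #|D|]|.

End ZeroForcing.

Section TriangularSnake.
Variable n : nat.

(* Indices are shifted down by one: inl i is v_(i+1) and inr i is u_(i+1). *)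
Definition snake_vertex : finType := ('I_n.+1 + 'I_n)%type.

Definition snake_arc (x y : snake_vertex) : bool :=
  match x, y with
  | inl i, inl j => j == i.+1 :> nat
  | inr i, inl j => (j == i :> nat) || (j == i.+1 :> nat)
  | _, _ => false
  end.

Definition snake_adj : rel snake_vertex := fun x y =>
  snake_arc x y || snake_arc y x.

Lemma snake_adj_sym : symmetric snake_adj.
Proof. by move=> x y; rewrite /snake_adj orbC. Qed.

Lemma snake_adj_irrefl : irreflexive snake_adj.
Proof. by case=> i; rewrite /snake_adj //= orbb ltn_eqF. Qed.

Definition triangular_snake : sgraph := SGraph snake_adj_sym snake_adj_irrefl.

End TriangularSnake.

(* Main.v *)
Require Import Defs.
From mathcomp Require Import all_boot zify.

(** Colour the edges by the n triangles.  When v forces w inside a triangle, all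
    neighbours of v become black, so that triangle becomes entirely black, and
    it was not before; hence every force uses up a new triangle and at most n of
    the 2n+1 vertices are ever forced.  Conversely v_1 together with all the u_i
    is a dominating set, from which v_i forces v_(i+1) successively. *)

Section Numbers.
Variable G : sgraph.
Implicit Types B D : {set G}.

Lemma zero_forcing_number_le B : zero_forcing B -> zero_forcing_number G <= #|B|.
Proof.
by rewrite /zero_forcing_number; case: arg_minnP => [|A _ minA /minA//];
  exact: zero_forcingT.
Qed.

Lemma dom_forcing_number_le D : dom_forcing D -> dom_forcing_number G <= #|D|.
Proof.
by rewrite /dom_forcing_number; case: arg_minnP => [|A _ minA /minA//];
  exact: dom_forcingT.
Qed.

Lemma zero_forcing_le_dom_forcing :
  zero_forcing_number G <= dom_forcing_number G.
Proof.
rewrite [X in _ <= X]/dom_forcing_number.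
case: arg_minnP => [|D /andP[_ zfD] _]; first exact: dom_forcingT.
exact: zero_forcing_number_le.
Qed.

Section CliqueCover.
Variables (I : finType) (K : I -> {set G}).
Hypothesis K_clique : forall i, {in K i &, forall x y, x != y -> adj x y}.
Hypothesis K_cover : forall x y : G, adj x y -> exists2 i, x \in K i & y \in K i.

Let black_cliques B := [set i | K i \subset B].

(** The clique [K i] covering the edge from [v] to the forced [w] is not black before the step, as
    [w] is white. It is black afterwards: its vertices other than [v] are neighbours of [v], whose
    only white neighbour was [w]. *)
Lemma force_step_black_cliques B B' : force_step B B' ->
  #|B'| + #|black_cliques B| <= #|B| + #|black_cliques B'|.
Proof.
case/existsP=> v /andP[vB /existsP[w /andP[/eqP white_v /eqP->]]].
have: w \in white_neigh B v by rewrite white_v set11.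
rewrite !inE => /andP[wB /K_cover[i vK wK]].
rewrite cardsU1 wB add1n addSnnS leq_add2l.
apply/proper_card/properP; split.
  by apply/subsetP=> j; rewrite !inE => /subset_trans; apply; exact: subsetUr.
exists i; rewrite inE; last by apply: contra wB => /subsetP; apply.
apply/subsetP=> x xK; have [->|xv] := eqVneq x v; first by rewrite !inE vB orbT.
rewrite !inE; have [//|xB] := boolP (x \in B); first by rewrite orbT.
have: x \in white_neigh B v by rewrite !inE xB (K_clique i) // eq_sym.
by rewrite white_v inE => ->.
Qed.

(** Black vertices minus black cliques never increases along a forcing sequence; the sums avoid
    truncated subtraction. *)
Lemma zero_forcing_clique_cover B : zero_forcing B -> #|G| <= #|B| + #|I|.
Proof.
case/connectP=> p pB lastp.
suff: #|[set: G]| + #|black_cliques B| <= #|B| + #|black_cliques [set: G]|.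
  rewrite cardsT => le_card; apply: leq_trans (leq_addr _ _) (leq_trans le_card _).
  by rewrite leq_add2l max_card.
elim: p B pB lastp => [B _ -> //|C p IHp B /= /andP[/force_step_black_cliques stepBC]].
by move=> pC /(IHp C pC); move: stepBC; lia.
Qed.

Lemma zero_forcing_number_clique_cover : #|G| <= zero_forcing_number G + #|I|.
Proof.
rewrite /zero_forcing_number; case: arg_minnP => [|B zfB _].
  exact: zero_forcingT.
exact: zero_forcing_clique_cover.
Qed.

End CliqueCover.
End Numbers.

Section Snake.
Variable n : nat.
Local Notation TS := (triangular_snake n).

Definition triangle (i : 'I_n) : {set TS} :=
  [set x : snake_vertex n | match x with inl j => (j == i :> nat) || (j == i.+1 :> nat)
                      | inr j => j == i end].

Lemma triangle_clique i : {in triangle i &, forall x y, x != y -> adj x y}.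
Proof.
move=> [x|x] [y|y]; rewrite !inE /adj /= /snake_adj /=.
- move=> xi yi; have [/val_inj-> /eqP//|xy _] := eqVneq (x : nat) y; lia.
- by move=> xi /eqP->; rewrite xi.
- by move=> /eqP-> ->.
- by move=> /eqP-> /eqP-> /eqP.
Qed.

Lemma triangle_cover (x y : TS) :
  adj x y -> exists2 i, x \in triangle i & y \in triangle i.
Proof.
(* Adjacency is the symmetric closure of [snake_arc], and an arc lies in the triangle indexed by its
   source. *)
have arc (a b : TS) : snake_arc a b ->
    exists2 i, a \in triangle i & b \in triangle i.
  case: a b => [a|a] [b|b] //= ab.
    have an : a < n by move/eqP: ab (ltn_ord b) => ->.
    by exists (Ordinal an); rewrite inE /= ?eqxx ?ab ?orbT.
  by exists a; rewrite inE.
by case/orP=> /arc[i]; exists i.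
Qed.

(** The black set after [k] forces, starting from the first path vertex and all the apices. *)
Definition snake_front k : {set TS} :=
  [set x : snake_vertex n | match x with inl i => i <= k | inr _ => true end].

Lemma card_snake_front0 : #|snake_front 0| = n.+1.
Proof.
rewrite cardsE -sum1_card big_sumType /= sum1_card.
rewrite (eq_card (B := pred1 ord0)) => [|i]; last first.
  by rewrite unfold_in -[LHS]/(i <= 0) leqn0.
by rewrite card1 sum1_card card_ord.
Qed.

Lemma snake_front_step k :
  k < n -> force_step (snake_front k) (snake_front k.+1).
Proof.
move=> kn; have k1 : k < n.+1 by exact: ltnW.
(* The last black path vertex forces the next one: its other neighbours are apices or the preceding
   path vertex, all black. *)
apply/existsP; exists (inl (Ordinal k1)); rewrite inE /= leqnn /=.
apply/existsP; exists (inl (Ordinal (kn : k.+1 < n.+1))).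
apply/andP; split; apply/eqP/setP=> -[i|i]; rewrite !inE //=.
- rewrite /adj /= /snake_adj /= -[inl i == _]/(i == _ :> nat) /=; lia.
- by rewrite -[inl i == _]/(i == _ :> nat) /= leq_eqVlt.
Qed.

Lemma zero_forcing_snake_front0 : zero_forcing (snake_front 0).
Proof.
have front k : k <= n -> connect (@force_step TS) (snake_front 0) (snake_front k).
  elim: k => [|k IHk] kn; first exact: connect0.
  apply: connect_trans (IHk (ltnW kn)) (connect1 _); exact: snake_front_step.
rewrite /zero_forcing.
suff <- : snake_front n = [set: TS] by exact: front.
by apply/setP=> -[i|i]; rewrite !inE //; exact: leq_ord.
Qed.

Lemma dominating_snake_front0 : dominating (snake_front 0).
Proof.
apply/forallP=> -[i|i]; rewrite !inE //=.
have [//|i_gt0] := leqP i 0; apply/existsP.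
(* A path vertex other than the first is dominated by the apex of the triangle on its left. *)
have i1n : i.-1 < n by case: i i_gt0 => -[|i] //=.
by exists (inr (Ordinal i1n)); rewrite inE /adj /= /snake_adj /= prednK ?eqxx ?orbT.
Qed.

End Snake.

Theorem theorem3p2 (n : nat) (n_ge1 : 1 <= n) :
  dom_forcing_number (triangular_snake n)
    = zero_forcing_number (triangular_snake n) /\
  zero_forcing_number (triangular_snake n) = n + 1.
Proof.
have lower := zero_forcing_number_clique_cover _ _ _ (@triangle_clique n)
  (@triangle_cover n).
have middle := zero_forcing_le_dom_forcing (triangular_snake n).
have upper : dom_forcing_number (triangular_snake n) <= n.+1.
  rewrite -card_snake_front0; apply: dom_forcing_number_le.
  by rewrite /dom_forcing dominating_snake_front0 zero_forcing_snake_front0.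
(* With [2n+1] vertices and [n] triangles, [lower] gives at least [n+1], which closes the chain with
   [middle] and [upper]. *)
move: lower; rewrite card_sum !card_ord; lia.
Qed.
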